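(* For all integers $k\ge 2$, $1\leq \ell\leq k-1$ and $1\leq m\leq \lfloor\frac{k}{k-\ell}\rfloor$, we have \[\hat{R}_r\big(P^{(k,\ell)}_{\ell+(m+1)(k-\ell)}\big)=\Theta_{m,k}(r^{m}),\] i.e. there are constants $c,C>0$ depending only on $m$ and $k$ (and $\ell$) such that $c\,r^m\le \hat{R}_r(P^{(k,\ell)}_{\ell+(m+1)(k-\ell)})\le C\,r^m$ for all sufficiently large $r$. In particular, when $\ell=k-1$: for all $1\leq m\leq k$, $\hat{R}_r(P^{(k)}_{k+m})=\Theta_{m,k}(r^{m})$.
   Context: A $k$-graph is a $k$-uniform hypergraph. For hypergraphs $G,H$ and an integer $r\ge 1$, $G\to_r H$ means that every $r$-coloring of the edges of $G$ contains a monochromatic copy of $H$. For a $k$-graph $H$, the $r$-color size-Ramsey number $\hat R_r(H)$ is the minimum number of edges of a $k$-graph $G$ with $G\to_r H$. For $1\le \ell\le k-1$ and $m\ge 1$, the $k$-uniform $\ell$-overlapping path (or $(k,\ell)$-path) with $m$ edges is the $k$-graph with vertex set $\{v_1,\dots,v_{k+(m-1)(k-\ell)}\}$ and edges $\{v_{(i-1)(k-\ell)+1},\dots,v_{(i-1)(k-\ell)+k}\}$ for $i\in[m]$; $P_n^{(k,\ell)}$ denotes the $(k,\ell)$-path with $n$ vertices. $P_n^{(k)}:=P_n^{(k,k-1)}$ is the tight path. *)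

(* Defs.v *)
From HB Require Import structures.
From mathcomp Require Import all_boot all_order all_algebra.
From mathcomp Require Import reals.

Set Implicit Arguments.
Unset Strict Implicit.
Unset Printing Implicit Defensive.

Import Order.TTheory GRing.Theory Num.Theory.

Record kgraph (k : nat) := KGraph {
  vertex : finType;
  edges : {set {set vertex}};
  card_edge : forall e, e \in edges -> #|e| = k
}.

Section SizeRamsey.
Variable k : nat.
Implicit Types G H : kgraph k.

(* [c] is total on vertex sets, but only its values on [edges G] are used, so
   for r >= 1 these are exactly the r-colorings of the edges of G.
   Copies are not required to be induced. *)
Definition has_mono_copy r H G (c : {set vertex G} -> 'I_r) : Prop :=
  exists (f : vertex H -> vertex G) (a : 'I_r),
    injective f /\
    forall e, e \in edges H -> f @: e \in edges G /\ c (f @: e) = a.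

Definition arrows r G H : Prop :=
  forall c : {set vertex G} -> 'I_r, has_mono_copy H c.

(* A relation rather than a function: asserting it includes the existence of
   some G with [arrows r G H], so no default value is involved. *)
Definition is_size_ramsey r H (N : nat) : Prop :=
  (exists G, arrows r G H /\ #|edges G| = N) /\
  (forall G, arrows r G H -> (N <= #|edges G|)%N).

Definition size_ramsey_Theta (R : realType) H (m : nat) : Prop :=
  exists c C : R, [/\ (0 < c)%R, (0 < C)%R &
    exists r0 : nat, forall r : nat, (r0 <= r)%N ->
      exists N : nat, is_size_ramsey r H N /\
        (c * r%:R ^+ m <= N%:R <= C * r%:R ^+ m)%R].

End SizeRamsey.

Section OverlappingPaths.
Variables k l : nat.

(* Vertices and edges are numbered from 0. *)
Definition opath_order q := k + (q - 1) * (k - l).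

Definition opath_edge q (i : 'I_q) : {set 'I_(opath_order q)} :=
  [set v : 'I_(opath_order q) | i * (k - l) <= v < i * (k - l) + k].

Lemma card_opath_edge q e :
  e \in [set opath_edge i | i : 'I_q] -> #|e| = k.
Proof.
case/imsetP=> i _ ->.
have le_iN : i * (k - l) + k <= opath_order q.
  rewrite /opath_order addnC leq_add2l leq_mul2r.
  by rewrite subn1 -ltnS prednK ?ltn_ord ?orbT // (leq_ltn_trans _ (ltn_ord i)).
pose h (j : 'I_k) : 'I_(opath_order q) :=
  Ordinal (leq_trans (eq_leq (esym (addnS _ j)))
    (leq_trans (leq_add (leqnn (i * (k - l))) (ltn_ord j)) le_iN)).
have h_inj : injective h.
  by move=> j1 j2 /(congr1 val) /= /addnI /val_inj.
rewrite -[RHS]card_ord -(card_imset 'I_k h_inj); apply: eq_card => v.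
rewrite inE; apply/andP/imsetP => [[le_iv lt_vi]|[j _ ->]] /=.
  have lt_jk : v - i * (k - l) < k by rewrite ltn_subLR.
  by exists (Ordinal lt_jk) => //; apply: val_inj; rewrite /= subnKC.
by rewrite leq_addr ltn_add2l.
Qed.

(* The l-overlapping path with q edges (q >= 1). *)
Definition opath q : kgraph k := KGraph (@card_opath_edge q).

(* The l-overlapping path on n vertices, where n = k + (q - 1) (k - l) for some
   q >= 1, i.e. n = l + q (k - l); see [card_opathn]. *)
Definition opathn n : kgraph k := opath ((n - l) %/ (k - l)).

Lemma opathnE q : l < k -> opathn (l + q * (k - l)) = opath q.
Proof. by move=> ltlk; rewrite /opathn addKn mulnK ?subn_gt0. Qed.

Lemma card_opathn q : l < k -> 0 < q ->
  #|vertex (opathn (l + q * (k - l)))| = l + q * (k - l).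
Proof.
move=> ltlk; rewrite opathnE // card_ord /opath_order; case: q => // q _.
by rewrite subn1 mulSn addnA subnKC // ltnW.
Qed.

End OverlappingPaths.

Definition tight_path k n : kgraph k := opathn k (k - 1) n.

(* Main.v *)
(* Put s = k - l and d(S) = number of edges containing S.  In the path with m + 1
   edges, passing from each edge to the next replaces a block of s vertices by a
   fresh one, and the m blocks replaced are disjoint since m s <= k.

   Upper bound: let the edges be indexed by [N]^m, with N = m r + 1.  A colour
   class A has more than m N^(m-1) points, so it contains a chain in which each
   of the m coordinates is changed once, in order; this chain is a path.

   Lower bound: let q be a small constant times r, and suppose that G has fewer
   than q^m edges.  Give e and e' different colours whenever some S contained in
   both has d(S) < q^(j+1) while d(S :|: (e' :\: e)) >= q^j.  Each e has O(q) such
   e', so r colours suffice.  In a monochromatic path, induction on j then shows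
   that the intersection of the first j + 1 edges has degree at least q^j, which
   for j = m contradicts the bound on the number of edges. *)
Require Import Defs.
From mathcomp Require Import all_boot all_order all_algebra.
From mathcomp Require Import boolp reals zify.

Set Implicit Arguments.
Unset Strict Implicit.
Unset Printing Implicit Defensive.

Import Order.TTheory GRing.Theory Num.Theory.

(** * Union bound and colouring of digraphs of bounded outdegree *)

Lemma leq_card_bigcup (T I : finType) (P : {set I}) (F : I -> {set T}) b :
  (forall i, i \in P -> #|F i| <= b) -> #|\bigcup_(i in P) F i| <= #|P| * b.
Proof.
move=> le_b; rewrite -sum_nat_const.
apply: (big_ind2 (fun (X : {set T}) n => #|X| <= n)) => [|X m Y n leX leY|//].
  by rewrite cards0.
by rewrite (leq_trans (leq_card_setU X Y)) ?leq_add.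
Qed.

(* Averaging over in-degrees yields a vertex of total degree at most [2 D]. *)
Lemma outdegree_coloring (T : finType) (R : rel T) D r (A : {set T}) :
  D.*2 < r -> (forall x, x \in A -> #|[set y in A | R x y]| <= D) ->
  exists c : T -> 'I_r,
    {in A &, forall x y, x != y -> R x y -> c x != c y}.
Proof.
move=> ltDr; move: {2}#|A| (erefl #|A|) => n; elim: n A => [|n IHn] A cardA degA.
  exists (fun=> Ordinal (leq_ltn_trans (leq0n _) ltDr)) => x y.
  by rewrite (cards0_eq cardA) inE.
have [y yA degy]: exists2 y, y \in A & #|[set x in A | R x y]| <= D.
  apply/exists_inP; apply: contraT; rewrite negb_exists_in => /forall_inP gtD.
  have: \sum_(y in A) #|[set x in A | R x y]| <= #|A| * D.
    rewrite -sum_nat_const.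
    have /leq_trans-> //: \sum_(y in A) #|[set x in A | R x y]| <=
        \sum_(x in A) #|[set y in A | R x y]|.
      under eq_bigr do rewrite cardsE -sum1_card big_mkcondr.
      under [X in _ <= X]eq_bigr do rewrite cardsE -sum1_card big_mkcondr.
      by rewrite exchange_big.
    exact: leq_sum.
  rewrite leqNgt -(prednK (n := #|A|)) ?cardA //= => /negP[].
  have: \sum_(y in A) D.+1 <= \sum_(y in A) #|[set x in A | R x y]|.
    by apply: leq_sum => y /gtD; rewrite -ltnNge.
  rewrite sum_nat_const cardA; apply: leq_trans.
  by rewrite mulnS addSn ltnS leq_addl.
have [||c cP] := IHn (A :\ y).
- by move: cardA; rewrite (cardsD1 y) yA => -[].
- move=> x /setD1P[_ xA]; apply: leq_trans (degA x xA); apply: subset_leq_card.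
  by apply/subsetP => z; rewrite !inE => /andP[/andP[_ ->] ->].
(* [B] has at most [D.*2] elements, fewer than the [r] colours, so a colour remains for [y]. *)
pose B := [set x in A | R x y] :|: [set x in A | R y x].
have [a aB]: exists a, a \notin c @: B.
  apply/existsP; apply: contraT; rewrite negb_exists => /forallP cB.
  have: #|'I_r| <= #|c @: B|.
    by apply: subset_leq_card; apply/subsetP => a _; have := cB a; rewrite negbK.
  rewrite card_ord leqNgt (leq_ltn_trans (leq_imset_card _ _)) //.
  rewrite (leq_ltn_trans (leq_card_setU _ _)) // (leq_ltn_trans _ ltDr) //.
  by rewrite -addnn leq_add // degA.
exists (fun x => if x == y then a else c x) => x z xA zA neq_xz Rxz.
have [eq_xy|neq_xy] := eqVneq x y; have [eq_zy|neq_zy] := eqVneq z y.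
- by rewrite eq_xy eq_zy eqxx in neq_xz.
- apply: contraNneq aB => ->; apply: imset_f.
  by rewrite !inE zA -eq_xy Rxz orbT.
- apply: contraNneq aB => <-; apply: imset_f.
  by rewrite !inE xA -eq_zy Rxz.
- by apply: cP; rewrite // !inE ?neq_xy ?neq_zy.
Qed.

(** * Lower bound: degrees of vertex sets and conflicting edges *)

Section LowerBound.
Variables (k m q : nat) (G : kgraph k).
Implicit Types S T e : {set vertex G}.

Definition codegree S := #|[set e in edges G | S \subset e]|.

Definition heavy_extensions j S :=
  [set T : {set vertex G} | S \subset T & q ^ j <= codegree T].

(** Double count pairs of a heavy [T] and an edge containing it: each [T] lies in at least [q ^ j]
    edges, all among the fewer than [q ^ j.+1] edges containing [S], and each edge has [2 ^ k]
    subsets. *)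
Lemma card_heavy_extensions j S :
  0 < q -> codegree S < q ^ j.+1 -> #|heavy_extensions j S| <= 2 ^ k * q.
Proof.
move=> q_gt0 lightS; rewrite -(leq_pmul2r (m := q ^ j)) ?expn_gt0 ?q_gt0 //.
rewrite -mulnA -expnS (leq_trans _ (leq_mul (leqnn _) (ltnW lightS))) //.
rewrite -sum_nat_const.
have /leq_trans-> //: \sum_(T in heavy_extensions j S) q ^ j <=
    \sum_(T in heavy_extensions j S) codegree T.
  by apply: leq_sum => T; rewrite inE => /andP[].
rewrite /codegree; under eq_bigr do rewrite cardsE -sum1_card big_mkcondr.
rewrite exchange_big /= (bigID (fun e => S \subset e)) /= [X in _ + X]big1.
  rewrite addn0 mulnC cardsE -sum_nat_const leq_sum // => e /andP[eG _].
  rewrite -big_mkcondr sum1_card.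
  have <-: #|powerset e| = 2 ^ k by rewrite card_powerset (card_edge eG).
  by apply: subset_leq_card; apply/subsetP => T; rewrite !inE => /andP[_].
move=> e /andP[_ /negP nSe]; rewrite big1 // => T; rewrite inE => /andP[ST _].
by case: ifP => // Te; case: nSe; apply: subset_trans Te.
Qed.

Definition conflict e e' :=
  [exists j : 'I_m, [exists S : {set vertex G},
    [&& S \subset e, S \subset e', codegree S < q ^ j.+1
      & q ^ j <= codegree (S :|: (e' :\: e))]]].

(* A conflicting [e'] is recovered as [T :|: (e :&: e')], where
   [T := S :|: (e' :\: e)] is a heavy extension of a light subset of [e]. *)
Lemma card_conflict e : 0 < q -> e \in edges G ->
  #|[set e' in edges G | conflict e e']| <= m * (2 ^ k * (2 ^ k * (2 ^ k * q))).
Proof.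
move=> q_gt0 eG; pose light j := [set S in powerset e | codegree S < q ^ j.+1].
pose F (j : 'I_m) := \bigcup_(S in light j) \bigcup_(U in powerset e)
  [set T :|: U | T in heavy_extensions j S].
have cpow: #|powerset e| = 2 ^ k by rewrite card_powerset (card_edge eG).
apply: (@leq_trans #|\bigcup_(j in [set: 'I_m]) F j|).
  apply: subset_leq_card; apply/subsetP => e'; rewrite inE => /andP[_].
  case/existsP=> j /existsP[S /and4P[Se Se' lightS heavyT]].
  apply/bigcupP; exists j; first by rewrite inE.
  apply/bigcupP; exists S; first by rewrite !inE Se.
  apply/bigcupP; exists (e :&: e'); first by rewrite inE subsetIl.
  apply/imsetP; exists (S :|: (e' :\: e)); first by rewrite inE subsetUl.
  apply/setP => v; rewrite !inE; have := subsetP Se v; have := subsetP Se' v.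
  by case: (v \in S) => [-> //|]; case: (v \in e); case: (v \in e').
(* The factors [m], [2 ^ k], [2 ^ k], [2 ^ k * q] bound the choices of [j], [S], [U] and [T] in
   turn. *)
rewrite (leq_trans (leq_card_bigcup (b := 2 ^ k * (2 ^ k * (2 ^ k * q))) _)) //.
  move=> j _; rewrite (leq_trans (leq_card_bigcup (b := 2 ^ k * (2 ^ k * q)) _)) //.
    move=> S; rewrite inE => /andP[_ lightS].
    rewrite -cpow; apply: leq_card_bigcup => U _; rewrite cpow.
    by rewrite (leq_trans (leq_imset_card _ _)) // card_heavy_extensions.
  rewrite leq_mul2r -cpow subset_leq_card ?orbT //.
  by apply/subsetP => S; rewrite inE => /andP[].
by rewrite cardsT card_ord.
Qed.

End LowerBound.

Lemma arrows_edges_ge k l m q r (G : kgraph k) :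
  l < k -> m * (k - l) <= k -> 0 < q ->
  (m * (2 ^ k * (2 ^ k * (2 ^ k * q)))).*2 < r ->
  arrows r G (opath k l m.+1) -> q ^ m <= #|edges G|.
Proof.
move=> ltlk le_msk q_gt0 ltr GH; set s := k - l in le_msk *.
have s_gt0: 0 < s by rewrite subn_gt0.
have [c cP] := outdegree_coloring ltr (fun e => @card_conflict k m q G e q_gt0).
have [f [a [f_inj monof]]] := GH c.
(* The intersection of the first [j + 1] edges of the copy. *)
pose S j := f @: [set v : vertex (opath k l m.+1) | j * s <= v < k].
have edgeP (i : 'I_m.+1) : f @: opath_edge k l i \in edges G /\ c (f @: opath_edge k l i) = a.
  by apply: monof; apply: imset_f.
suff heavyS j : j <= m -> q ^ j <= codegree (S j).
  apply: leq_trans (heavyS m (leqnn m)) _; apply: subset_leq_card.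
  by apply/subsetP => e; rewrite inE => /andP[].
elim: j => [_|j IHj ltjm].
  rewrite expn0 card_gt0; apply/set0Pn; exists (f @: opath_edge k l ord0).
  by rewrite inE (edgeP ord0).1 imsetS //.
rewrite leqNgt; apply/negP => lightS.
have le_js_k: j.+1 * s <= k.
  by apply: leq_trans le_msk; rewrite leq_mul2r ltjm orbT.
have ltjm1: j < m.+1 by rewrite ltnS ltnW.
pose e := f @: opath_edge k l (Ordinal ltjm1).
pose e' := f @: opath_edge k l (Ordinal (ltjm : j.+1 < m.+1)).
have [eG ce] : e \in edges G /\ c e = a by apply: edgeP.
have [e'G ce'] : e' \in edges G /\ c e' = a by apply: edgeP.
have diffE: e :\: e' = f @: [set v : vertex (opath k l m.+1) | j * s <= v < j.+1 * s].
  apply/setP => x; apply/setDP/imsetP => [[/imsetP[v vj ->]]|[v]].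
    rewrite mem_imset // => vj1; exists v => //.
    by move: vj vj1; rewrite !inE -!/s /=; lia.
  rewrite inE => /andP[lev ltv] ->; rewrite !mem_imset // !inE -!/s /=.
  by lia.
have SE: S j = S j.+1 :|: (e :\: e').
  rewrite diffE -imsetU; congr [set f x | x in pred_of_set _]; apply/setP => v; rewrite !inE.
  by lia.
(* The conflict runs backwards, from [e'] to [e]: adding [e :\: e'] to the light [S j.+1] gives back
   the heavy [S j]. *)
have: c e' != c e.
  apply: cP => //.
    apply/eqP => eq_e; move: diffE; rewrite eq_e setDv => /esym/setP.
    have lt_js: j * s < opath_order k l m.+1.
      apply: leq_trans (leq_addr _ _); apply: leq_trans le_js_k.
      by rewrite ltn_mul2r s_gt0 ltnSn.
    move=> /(_ (f (Ordinal lt_js))); rewrite mem_imset // !inE /= leqnn.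
    by rewrite ltn_mul2r s_gt0 ltnSn.
  apply/existsP; exists (Ordinal ltjm); apply/existsP; exists (S j.+1).
  rewrite -SE lightS IHj ?(ltnW ltjm) //= !andbT; apply/andP; split;
    apply: imsetS; apply/subsetP => v; rewrite !inE -!/s /= => /andP[lev ltv].
    by lia.
  by lia.
by rewrite ce ce' eqxx.
Qed.

(** * Chains inside a dense set of points *)

Section Hybrids.
Variables (m N : nat) (A : {set {ffun 'I_m.+1 -> 'I_N}}).
Implicit Types f g : {ffun 'I_m.+1 -> 'I_N}.

Definition hybrid i f g : {ffun 'I_m.+1 -> 'I_N} :=
  [ffun j : 'I_m.+1 => if j < i then g j else f j].

(* Going from [B] to the points of [B] having another point of [B] on their line
   in direction [i] loses at most one point per line. *)
Lemma hybrid_step (B : {set {ffun 'I_m.+1 -> 'I_N}}) (i : 'I_m.+1) :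
  #|B| <= N ^ m + #|[set f in B |
    [exists g in B, (f i != g i) && [forall j, (j != i) ==> (f j == g j)]]]|.
Proof.
set B' := [set f in B | _]; rewrite -(cardsID B' B) addnC leq_add //; last first.
  by rewrite subset_leq_card // subsetIr.
pose h f : {ffun 'I_m -> 'I_N} := [ffun x => f (lift i x)].
rewrite -[X in X ^ _]card_ord -[X in _ ^ X]card_ord -card_ffun.
rewrite -(card_in_imset (f := h)) ?max_card // => f g.
move=> /setDP[fB fB'] /setDP[gB _] /ffunP eq_h.
have eq_fg j : j != i -> f j = g j.
  by case: (unliftP i j) => [x -> _|->]; [have := eq_h x; rewrite !ffunE | rewrite eqxx].
apply/ffunP => j; have [->|/eq_fg//] := eqVneq j i.
apply/eqP; apply: contraNT fB' => neq_fg; rewrite inE fB.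
apply/exists_inP; exists g => //; rewrite neq_fg.
by apply/forall_inP => x /eq_fg ->.
Qed.

(** Chains are built from their end, treating the coordinates from last to first; each of the [m.+1]
    rounds discards at most [N ^ m] points, so some starting point survives. *)
Lemma exists_hybrids : m.+1 * N ^ m < #|A| ->
  exists f g, (forall j, f j != g j) /\
    forall i, i <= m.+1 -> hybrid i f g \in A.
Proof.
move=> ltA.
suff /(_ m.+1 (leqnn _)) [B cardB BP]: forall n, n <= m.+1 ->
  exists2 B : {set {ffun 'I_m.+1 -> 'I_N}}, #|A| <= n * N ^ m + #|B| &
    forall f, f \in B -> exists g : {ffun 'I_m.+1 -> 'I_N},
      [/\ f \in A, forall j : 'I_m.+1, m.+1 - n <= j -> f j != g j,
          forall j : 'I_m.+1, j < m.+1 - n -> g j = f j &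
          forall i, m.+1 - n <= i -> i <= m.+1 -> hybrid i f g \in A].
  have /card_gt0P[f fB]: 0 < #|B|.
    by move: (leq_trans ltA cardB); rewrite -addn1 leq_add2l.
  have [g [_ neq _ hyb]] := BP f fB; rewrite subnn in neq hyb.
  by exists f, g; split=> [j|i]; [apply: neq | apply: hyb].
elim=> [_|n IHn ltn].
  exists A => // f fA; exists f; split=> // [j|i _ _].
    by rewrite subn0 leqNgt ltn_ord.
  by have -> : hybrid i f f = f by apply/ffunP => j; rewrite ffunE if_same.
have [B cardB BP] := IHn (ltnW ltn).
have lt_i : m.+1 - n.+1 < m.+1 by rewrite subSS ltnS leq_subr.
pose i := Ordinal lt_i.
have iS : m.+1 - n = i.+1 by rewrite /= subSS subSn.
exists [set f in B |
    [exists g in B, (f i != g i) && [forall j, (j != i) ==> (f j == g j)]]].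
  by rewrite mulSn addnAC (leq_trans cardB) // addnC leq_add2r hybrid_step.
move=> f; rewrite inE => /andP[fB /exists_inP[f' f'B /andP[neq_i /forall_inP eq_f]]].
have {eq_f} eq_f j : j != i -> f j = f' j by move/eq_f/eqP.
have [_ [fA _ _ _]] := BP f fB.
(* Prepend the move from [f] to [f'], in coordinate [i], to the chain from [f'] to [g]. *)
have [g [_ neq eq hyb]] := BP f' f'B; rewrite iS in neq eq hyb.
have neqP (j : 'I_m.+1) : (j != i) = (nat_of_ord j != i) by [].
exists g; rewrite -[m.+1 - n.+1]/(nat_of_ord i); split=> [//|j|j ltji|x].
- rewrite leq_eqVlt => /orP[/eqP/val_inj <-|ltij]; first by rewrite eq.
  by rewrite eq_f ?neq // neqP gtn_eqF.
- by rewrite eq ?eq_f ?neqP ?ltn_eqF // ltnW.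
- rewrite leq_eqVlt => /orP[/eqP <- _|ltix lexm].
    suff -> : hybrid i f g = f by [].
    apply/ffunP => j; rewrite ffunE; case: ifP => // ltji.
    by rewrite eq ?eq_f ?neqP ?ltn_eqF // ltnW.
  suff -> : hybrid x f g = hybrid x f' g by apply: hyb.
  apply/ffunP => j; rewrite !ffunE; case: ltnP => // lexj.
  by rewrite eq_f // neqP gtn_eqF // (leq_trans ltix).
Qed.

End Hybrids.

(** * Upper bound: a [k]-partite host hypergraph *)

Section UpperBound.
Variables (k l m N : nat).
Hypotheses (k_gt0 : 0 < k) (ltlk : l < k) (le_msk : m.+1 * (k - l) <= k).
Implicit Types f g : {ffun 'I_m.+1 -> 'I_N.+1}.

(* The positions below [m.+1 * (k - l)] form [m.+1] blocks of length [k - l],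
   each carrying one coordinate of [g]; the other ones are fixed. *)
Definition block_value g t : 'I_N.+1 := oapp g ord0 (insub (t %/ (k - l))).

Definition block_edge g : {set 'I_N.+1 * 'I_k} :=
  [set (block_value g t, t) | t : 'I_k].

Lemma card_block_edge e : e \in [set block_edge g | g in predT] -> #|e| = k.
Proof.
case/imsetP => g _ ->; rewrite card_imset ?card_ord //.
by move=> t u [].
Qed.

Definition block_kgraph : kgraph k := KGraph card_block_edge.

Lemma card_block_kgraph : #|edges block_kgraph| <= N.+1 ^ m.+1.
Proof.
rewrite (leq_trans (leq_imset_card _ _)) //.
by rewrite -[X in #|X|]/(pred_of_simpl predT) card_ffun !card_ord.
Qed.

Lemma block_valueE g (j : 'I_m.+1) t : t %/ (k - l) = j -> block_value g t = g j.
Proof. by move=> tj; rewrite /block_value tj valK. Qed.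

Lemma eq_block_value f g t :
  (forall j : 'I_m.+1, t %/ (k - l) = j -> f j = g j) ->
  block_value f t = block_value g t.
Proof.
by rewrite /block_value; case: insubP => //= j _ jt eq_fg; apply: eq_fg.
Qed.

(** The path winds around the [k] parts, with values from [f] on the first pass and from [g] on the
    second. *)
Definition path_point f g (p : nat) : 'I_N.+1 * 'I_k :=
  (block_value (if p < k then f else g) (p %% k), Ordinal (ltn_pmod p k_gt0)).

(** Distinct path vertices in one part are [p] and [p + k] with [p < m.+1 * (k - l)]; there [p] lies
    in a block, where [f] and [g] differ. *)
Lemma path_point_inj f g (v w : 'I_(opath_order k l m.+2)) :
  (forall j, f j != g j) -> path_point f g v = path_point f g w -> v = w.
Proof.
move=> neq; have neqP p : p < m.+1 * (k - l) -> block_value f p != block_value g p.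
  rewrite -ltn_divLR ?subn_gt0 // => ltp.
  by rewrite !(@block_valueE _ (Ordinal ltp)).
have modP (p : 'I_(opath_order k l m.+2)) :
    p %% k = if p < k then p : nat else p - k.
  have := ltn_ord p; rewrite {2}/opath_order subn1 /= => ltp.
  case: ltnP => [/modn_small //|lekp].
  by rewrite -{1}(subnK lekp) modnDr modn_small //; lia.
have ltP (p : 'I_(opath_order k l m.+2)) : p - k < m.+1 * (k - l) \/ p < k.
  have := ltn_ord p; rewrite {2}/opath_order subn1 /=; lia.
rewrite /path_point => -[eq_val eq_mod]; apply: val_inj => /=.
move: eq_val; rewrite eq_mod; move: eq_mod; rewrite !modP.
have := ltP v; have := ltP w.
case: (ltnP v k) => [ltvk|levk]; case: (ltnP w k) => [ltwk|lewk] ltw ltv eq_vw //.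
- by move/eqP; rewrite (negbTE (neqP _ _)) //; lia.
- by move/esym/eqP; rewrite (negbTE (neqP _ _)) //; lia.
- by move=> _; lia.
Qed.

(** Edge [i] meets the first [i] blocks on the second pass and all other positions on the first.
    Both sides have [k] elements, so one inclusion suffices. *)
Lemma path_point_edge f g (i : 'I_m.+2) : (forall j, f j != g j) ->
  [set path_point f g (val v) | v in opath_edge k l i] = block_edge (hybrid i f g).
Proof.
move=> neq; apply/eqP; rewrite eqEcard; apply/andP; split; last first.
  rewrite [X in X <= _](@card_block_edge (block_edge (hybrid i f g))) ?imset_f //.
  rewrite card_imset => [|v w]; last exact: path_point_inj.
  by rewrite (@card_opath_edge k l m.+2) ?imset_f.
have s_gt0: 0 < k - l by rewrite subn_gt0.
apply/subsetP => x /imsetP[v]; rewrite inE => /andP[lev ltv] ->.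
apply/imsetP; exists (Ordinal (ltn_pmod v k_gt0)) => //; congr pair.
apply: eq_block_value => j; rewrite ffunE.
have le_isk : i * (k - l) <= k.
  by apply: leq_trans le_msk; rewrite leq_mul2r -ltnS ltn_ord orbT.
case: ltnP => [ltvk|lekv].
  rewrite modn_small // => eq_j; rewrite ltnNge -eq_j.
  by rewrite leq_divRL // lev.
rewrite -{1}(subnK lekv) modnDr modn_small; last first.
  by rewrite ltn_subLR // (leq_trans ltv) // leq_add2r.
by move=> <-; rewrite ltn_divLR // ltn_subLR // addnC ltv.
Qed.

Lemma arrows_block_kgraph r :
  0 < r -> m.+1 * r <= N -> arrows r block_kgraph (opath k l m.+2).
Proof.
move=> r_gt0 le_N c.
pose A a := [set g : {ffun 'I_m.+1 -> 'I_N.+1} | c (block_edge g) == a].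
(* Pigeonhole: otherwise the [r] classes cover at most [r * m.+1 * N.+1 ^ m] points, which is less
   than [N.+1 ^ m.+1]. *)
have [a ltA]: exists a, m.+1 * N.+1 ^ m < #|A a|.
  apply/existsP; apply: contraT; rewrite negb_exists => /forallP leA.
  have: N.+1 ^ m.+1 <= r * (m.+1 * N.+1 ^ m).
    rewrite -[X in X ^ _]card_ord -[X in _ ^ X]card_ord -card_ffun -sum1_card.
    rewrite (partition_big (fun g => c (block_edge g)) predT) //=.
    apply: (@leq_trans (\sum_(a < r) m.+1 * N.+1 ^ m)); last first.
      by rewrite sum_nat_const card_ord.
    apply: leq_sum => a _.
    by rewrite sum1_card; move: (leA a); rewrite -leqNgt cardsE.
  by rewrite expnS mulnA leq_pmul2r ?expn_gt0 // leqNgt ltnS (mulnC r) le_N.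
have [f [g [neq hyb]]] := exists_hybrids ltA.
exists (fun v => path_point f g (val v)), a; split=> [v w|e].
  exact: path_point_inj.
case/imsetP => i _ ->; rewrite path_point_edge //; split; first exact: imset_f.
by have := hyb i (ltn_ord i); rewrite inE => /eqP.
Qed.

End UpperBound.

(** * Existence of the size-Ramsey number and choice of constants *)

Lemma size_ramsey_exists k (G H : kgraph k) r : arrows r G H ->
  exists2 N, is_size_ramsey r H N & N <= #|edges G|.
Proof.
move=> GH; pose P n := `[< exists G, arrows r G H /\ #|edges G| = n >].
have exP : exists n, P n by exists #|edges G|; apply/asboolP; exists G.
case: (ex_minnP exP) => N /asboolP exN minN; exists N; last first.
  by apply: minN; apply/asboolP; exists G.
by split=> // G' G'H; apply: minN; apply/asboolP; exists G'.
Qed.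

Lemma size_ramsey_opath (R : realType) k l m :
  l < k -> m.+1 * (k - l) <= k -> size_ramsey_Theta R (opath k l m.+2) m.+1.
Proof.
move=> ltlk le_msk; have k_gt0 : 0 < k by apply: leq_ltn_trans ltlk.
(* The colour requirement of [arrows_edges_ge] per unit of [q]; the successor makes it strict. *)
pose W := (m.+1 * (2 ^ k * (2 ^ k * 2 ^ k))).*2.+1.
(* With [q = r %/ W >= 1], [r < q.+1 * W <= 2 * W * q]; and [m.+1 * r + 1 <= m.+2 * r]. *)
exists ((2 * W)%:R ^- m.+1)%R, (m.+2%:R ^+ m.+1)%R; split.
- by rewrite invr_gt0 exprn_gt0 // ltr0n.
- by rewrite exprn_gt0 // ltr0n.
exists W => r leWr; have r_gt0 : 0 < r by apply: leq_trans leWr.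
have GH := arrows_block_kgraph k_gt0 ltlk le_msk r_gt0 (leqnn (m.+1 * r)).
have [N ramN leN] := size_ramsey_exists GH; exists N; split=> //.
have [[G [arG cardG]] _] := ramN.
pose q := r %/ W; have q_gt0 : 0 < q by rewrite divn_gt0.
have leWq : W * q <= r by rewrite mulnC leq_trunc_div.
have leq_N : q ^ m.+1 <= N.
  rewrite -cardG; apply: arrows_edges_ge arG => //; apply: leq_trans leWq.
  by rewrite /W; nia.
apply/andP; split.
  rewrite mulrC ler_pdivrMr ?exprn_gt0 ?ltr0n // -!natrX -natrM ler_nat.
  apply: leq_trans (leq_mul leq_N (leqnn _)); rewrite -expnMn leq_exp2r //.
  have ltrW : r < q.+1 * W by apply: ltn_ceil.
  rewrite (leq_trans (ltnW ltrW)) // mulnA leq_mul2r.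
  by rewrite muln2 -addnn -addn1 leq_add2l q_gt0 orbT.
rewrite -exprMn -natrM -natrX ler_nat (leq_trans leN) //.
rewrite (leq_trans (card_block_kgraph _ _ _ _)) // leq_exp2r //.
by rewrite [X in _ <= X]mulSn -add1n leq_add2r.
Qed.

Theorem theorem1p3 (R : realType) :
  (forall k l m : nat,
     2 <= k -> 1 <= l -> l <= k - 1 -> 1 <= m -> m <= k %/ (k - l) ->
     size_ramsey_Theta R (opathn k l (l + (m + 1) * (k - l))) m) /\
  (forall k m : nat,
     2 <= k -> 1 <= m -> m <= k ->
     size_ramsey_Theta R (tight_path k (k + m)) m).
Proof.
have main k l m : l < k -> 1 <= m -> m <= k %/ (k - l) ->
    size_ramsey_Theta R (opathn k l (l + (m + 1) * (k - l))) m.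
  case: m => // m ltlk _; rewrite leq_divRL ?subn_gt0 // => le_msk.
  by rewrite opathnE // addn1; apply: size_ramsey_opath.
split=> [k l m k2 _ lelk|k m k2 m_gt0 lemk].
  by apply: main; lia.
have s1 : k - (k - 1) = 1 by lia.
have := @main k (k - 1) m; rewrite s1 divn1 muln1.
have -> : k - 1 + (m + 1) = k + m by lia.
by apply=> //; lia.
Qed.
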